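(* Let $n\ge 1$ be an integer and write $n = 3k + r$ where $r \in \{0,1,2\}$ and $k$ is a nonnegative integer. Then $$|\mathsf{AMS}_n| = 2^{n-1} - \sum_{i=0}^{k-1}2^{3i+r}\,C_{2(k-i)-1,\;k-i}.$$
   Context: For a positive integer $n$, write $[n]=\{1,\dots,n\}$. A Stirling permutation of order $n$ is a word $w = w(1)w(2)\cdots w(2n)$ consisting of the multiset of letters $\{1,1,\ldots,n,n\}$ (each value of $[n]$ appears exactly twice), such that for each $1\le k\le n$, all of the values appearing between the two copies of $k$ in $w$ are larger than $k$. $Q_n$ denotes the set of Stirling permutations of order $n$. For $w\in Q_n$, if there is an index $i\in\{2,\ldots,2n-2\}$ such that $w(i-1)<w(i)=w(i+1)>w(i+2)$, then the value $w(i)$ is called a mesa of $w$. $\mathrm{Mesa}(w)\subseteq[n]$ denotes the set of all mesas of $w$. $\mathsf{AMS}_n=\{\mathrm{Mesa}(w): w\in Q_n\}$ is the set of admissible mesa sets for Stirling permutations of order $n$, and $|\mathsf{AMS}_n|$ is its cardinality. For coprime positive integers $m,\ell$, the rational Catalan number is $C_{m,\ell}=\frac{1}{\ell}\binom{\ell+m-1}{m}$. The empty sum (when $k=0$) is $0$. *)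

(* Defs.v *)
From mathcomp Require Import all_boot all_order all_algebra.

Set Implicit Arguments.
Unset Strict Implicit.
Unset Printing Implicit Defensive.

(* A word of length 2n over [n] is a tuple over 'I_n, where v : 'I_n encodes  *)
(* the value v + 1 of [n] = {1, ..., n}.                                      *)

(* Given that every value occurs exactly twice, the positions p < q with      *)
(* equal letters are exactly those of the two copies of some value.           *)
Definition stirling_perm n (w : (2 * n).-tuple 'I_n) : bool :=
  [forall v : 'I_n, count_mem v w == 2] &&
  [forall p : 'I_(2 * n), forall j : 'I_(2 * n), forall q : 'I_(2 * n),
    (p < j < q) && (tnth w p == tnth w q) ==> (tnth w p < tnth w j)].

Definition Q n : {set (2 * n).-tuple 'I_n} := [set w | stirling_perm w].

(* The letter w(i) as a natural number in [n], for 1 <= i <= 2n.              *)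
Definition letter n (w : (2 * n).-tuple 'I_n) (i : nat) : nat :=
  nth 0 [seq (val x).+1 | x <- w] i.-1.

(* index_iota 2 (2 * n - 1) enumerates {2, ..., 2n - 2}; it is empty if n = 1. *)
Definition Mesa n (w : (2 * n).-tuple 'I_n) : {set 'I_n} :=
  [set v : 'I_n | has (fun i => [&& letter w i == v.+1,
                                    letter w i.-1 < letter w i,
                                    letter w i == letter w i.+1
                                  & letter w i.+2 < letter w i.+1])
                      (index_iota 2 (2 * n - 1))].

Definition AMS n : {set {set 'I_n}} := [set Mesa w | w in Q n].

Definition rat_catalan (m l : nat) : rat :=
  (l%:R^-1 * 'C(l + m - 1, m)%:R)%R.

(* Main.v *)
Require Import Defs.
From mathcomp Require Import all_boot all_order all_algebra.
From mathcomp Require Import zify.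

(** The proof rests on a characterization of the admissible sets: [S] is the
    mesa set of some Stirling permutation of order [n >= 1] exactly when, for
    every value [v], fewer than twice as many values up to [v] lie in [S] as
    lie outside it ([AMS_admissible]).

    Necessity ([Mesa_admissible]). The two letters next to a mesa are smaller
    than it and are not mesas themselves. Send each mesa up to [v] to the
    position just to its right. This is an injection into the positions that
    carry a non-mesa letter up to [v], which are twice as many as the non-mesa
    values up to [v]; and it misses the leftmost of these positions, because
    the letter on the left of a mesa is also a non-mesa.

    Sufficiency ([admissible_Mesa]). Write each non-mesa twice, in increasing
    order, as [t_0 <= t_1 <= ...], and let [m_0 < m_1 < ...] be the elements of
    [S]. The word [t_0 m_0 m_0 t_1 m_1 m_1 t_2 ...], continued by the unused
    [t_i], works: admissibility says that [t_(i+1)] exists and is smaller than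
    [m_i], whence so is [t_i].

    Counting. Reading the values in increasing order, an admissible set is a
    lattice path with steps [+2] (non-mesa) and [-1] (mesa) that stays positive
    after every step ([card_admissible]). The first step has to be [+2]; of the
    [2 ^ (n - 1)] continuations one removes those that reach 0, sorted by the
    time of their first visit to 0, after which the path is arbitrary
    ([survivors_first_passage]). The number of first passages is given by a
    ballot formula ([first_passage_ballot]), which is the rational Catalan
    number of the statement ([rat_catalan_first_passage]). *)

(** * Lattice paths with steps +2 and -1 *)

(** The paths of [m] steps from height [h] that are positive after each step.
    The starting height itself may be 0. *)
Fixpoint survivors m h :=
  if m is m'.+1 then
    survivors m' h.+2 + (if 1 < h then survivors m' h.-1 else 0)
  else 1.

(** The paths of [m] steps from height [h] that are at 0 for the first time
    after the last step. *)
Fixpoint first_passage m h :=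
  match m, h with
  | 0, _ => nat_of_bool (h == 0)
  | m'.+1, 0 => 0
  | m'.+1, h'.+1 => first_passage m' h'.+3 + first_passage m' h'
  end.

(** Each of the [2 ^ m] paths either survives or has a first visit to 0, at
    some time [j], followed by [m - j] free steps. *)
Lemma survivors_first_passage m h : 0 < h ->
  survivors m h + \sum_(0 <= j < m.+1) first_passage j h * 2 ^ (m - j) = 2 ^ m.
Proof.
elim: m h => [|m IHm] [|h] // _; first by rewrite big_nat1.
rewrite big_nat_recl //= mul0n add0n.
under eq_bigr do rewrite subSS mulnDl.
rewrite big_split expnS mul2n -addnn -{1}(IHm h.+3) // /=.
suff -> : 2 ^ m = (if 1 < h.+1 then survivors m h else 0) +
    \sum_(0 <= j < m.+1) first_passage j h * 2 ^ (m - j) by rewrite addnACA.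
case: h => [|h]; last by rewrite -(IHm h.+1).
by rewrite big_nat_recl //= subn0 big1 ?addn0 ?mul1n // => j _.
Qed.

(** A path from [h] to 0 with [u] steps up needs [2 * u + h] steps down. *)
Lemma first_passage_support m h :
  0 < first_passage m h -> exists u, m = 3 * u + h.
Proof.
elim: m h => [|m IHm] [|h] //=; first by exists 0.
rewrite addn_gt0 => /orP[] /IHm[u ->]; first by exists u.+1; lia.
by exists u; lia.
Qed.

(** The hitting time theorem for these walks: a fraction [h / m] of all the
    paths of [m = 3 * u + h] steps from [h] to 0 avoids 0 until the end. The
    formula satisfies the recursion on the first step, which comes down to
    [(u + 1) * 'C(m, u + 1) = (m - u) * 'C(m, u)]. *)
Lemma first_passage_ballot u h :
  (3 * u + h) * first_passage (3 * u + h) h = h * 'C(3 * u + h, u).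
Proof.
have [m Em] : exists m, m = 3 * u + h by exists (3 * u + h).
rewrite -Em; elim: m u h Em => [|m IHm] u [|h] Em; rewrite ?muln0 //=; try lia.
have Hdown := IHm u h.
(* If [u = 0], the [m = h] steps that remain cannot come down from [h + 3];
   the last factor makes the right-hand side vanish as well. *)
have Hup : m * first_passage m h.+3 = h.+3 * 'C(m, u.-1) * (0 < u).
  case: u Em {Hdown} => [|u] Em; last by rewrite muln1; apply: IHm; lia.
  rewrite muln0; case E: (first_passage _ _) => [|c]; first by rewrite muln0.
  by have [|u] := first_passage_support m h.+3; rewrite ?E //; lia.
have [m0|m_gt0] := posnP m.
  have [-> ->] : u = 0 /\ h = 0 by lia.
  by rewrite m0.
apply/eqP; rewrite -(eqn_pmul2l m_gt0); apply/eqP.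
have {}Hdown := Hdown ltac:(lia).
case: u Em Hdown Hup => [|u] Em Hdown Hup.
  rewrite mulnCA mulnDr Hup Hdown !bin0; have -> : h = m by lia.
  lia.
rewrite binS; have := mul_bin_left m u; rewrite /= in Hup *.
have -> : m - u = 2 * u.+1 + h.+1 by lia.
move: ('C(m, u.+1)) ('C(m, u)) Hdown Hup.
move: (first_passage _ _) (first_passage _ _) => a b X Y Ha Hb HXY.
have -> : m * (m.+1 * (a + b)) = m.+1 * (m * a) + m.+1 * (m * b) by lia.
rewrite Ha Hb; have -> : m = 3 * u + h + 3 by lia.
lia.
Qed.

(** * Counting admissible sets *)

(** The path that goes up at the values outside [S] and down at those in [S]
    stays positive when it starts from [h]. *)
Definition admissible h {n} (S : {set 'I_n}) :=
  [forall v : 'I_n, #|[set u in S | u <= v]| <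
                    h + 2 * #|[set u in ~: S | u <= v]|].

(** A path is its first step, coded by [b], followed by the path of [S]. *)
Definition cons_set (b : bool) {n} (S : {set 'I_n}) : {set 'I_n.+1} :=
  [set u | if unlift ord0 u is Some i then i \in S else b].

Lemma cons_set0 b n (S : {set 'I_n}) : (ord0 \in cons_set b S) = b.
Proof. by rewrite inE unlift_none. Qed.

Lemma cons_setS b n (S : {set 'I_n}) i :
  (lift ord0 i \in cons_set b S) = (i \in S).
Proof. by rewrite inE liftK. Qed.

Lemma cons_set_inj b n : injective (@cons_set b n).
Proof.
by move=> S T E; apply/setP=> i; rewrite -[LHS](cons_setS b) E cons_setS.
Qed.

Lemma cons_setP n (S : {set 'I_n.+1}) :
  exists T, S = cons_set (ord0 \in S) T.
Proof.
exists [set i | lift ord0 i \in S]; apply/setP=> u; rewrite inE.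
by case: unliftP => [i ->|->]; rewrite ?inE.
Qed.

Lemma setC_cons b n (S : {set 'I_n}) : ~: cons_set b S = cons_set (~~ b) (~: S).
Proof. by apply/setP=> u; rewrite !inE; case: unlift => // i; rewrite inE. Qed.

Lemma card_cons_set0 b n (S : {set 'I_n}) :
  #|[set u in cons_set b S | u <= @ord0 n]| = b.
Proof.
rewrite -sum1_card big_mkcond big_ord_recl big1 => [|i _].
  by rewrite inE cons_set0 /= addn0; case: b.
by rewrite inE andbF.
Qed.

Lemma card_cons_setS b n (S : {set 'I_n}) (v : 'I_n) :
  #|[set u in cons_set b S | u <= lift ord0 v]| = b + #|[set u in S | u <= v]|.
Proof.
rewrite -!sum1_card big_mkcond [in RHS]big_mkcond big_ord_recl inE cons_set0 /=.
by congr (_ + _); [case: b | apply: eq_bigr => i _; rewrite !inE liftK].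
Qed.

Lemma admissible_cons h b n (S : {set 'I_n}) :
  admissible h (cons_set b S) =
  if b then (1 < h) && admissible h.-1 S else admissible h.+2 S.
Proof.
have split0 : admissible h (cons_set b S) =
    (b < h + 2 * ~~ b) &&
    [forall v : 'I_n, b + #|[set u in S | u <= v]| <
                      h + 2 * (~~ b + #|[set u in ~: S | u <= v]|)].
  apply/forallP/andP => [adm | [adm0 /forallP admS] v].
    split; first by have := adm ord0; rewrite setC_cons !card_cons_set0.
    apply/forallP=> v; have := adm (lift ord0 v).
    by rewrite setC_cons !card_cons_setS.
  rewrite setC_cons; case: (unliftP ord0 v) => [i|] ->.
    by rewrite !card_cons_setS.
  by rewrite !card_cons_set0.
rewrite split0; case: b {split0} => /=; last first.
  rewrite addn_gt0 orbT; apply: eq_forallb => v.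
  by rewrite add0n mulnDr addnA addn2.
rewrite muln0 addn0; case: ltnP => //= h_gt1.
by apply: eq_forallb => v; case: h h_gt1.
Qed.

Lemma card_admissible n h :
  #|[set S : {set 'I_n} | admissible h S]| = survivors n h.
Proof.
elim: n h => [|n IHn] h /=.
  rewrite -[RHS](cards1 (set0 : {set 'I_0})); apply: eq_card => S.
  rewrite !inE (_ : S == set0); last by apply/eqP/setP=> -[].
  by apply/forallP=> -[].
set up := [set S : {set 'I_n} | admissible h.+2 S].
set down := [set S : {set 'I_n} | (1 < h) && admissible h.-1 S].
have -> : [set S : {set 'I_n.+1} | admissible h S] =
    (cons_set false @: up) :|: (cons_set true @: down).
  apply/setP=> S; rewrite !inE; have [T ->] := cons_setP n S.
  rewrite admissible_cons; case: (ord0 \in S).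
    rewrite (mem_imset _ _ (@cons_set_inj _ _)) !inE.
    case: imsetP => // -[U _ /setP/(_ ord0)].
    by rewrite !cons_set0.
  rewrite (mem_imset _ _ (@cons_set_inj _ _)) !inE.
  case: imsetP => [[U _ /setP/(_ ord0)]|]; last by rewrite orbF.
  by rewrite !cons_set0.
rewrite cardsU !card_imset; try exact: cons_set_inj.
rewrite (_ : _ :&: _ = set0) ?cards0 ?subn0; last first.
  apply/setP=> S; rewrite !inE.
  apply/negP=> /andP[/imsetP[T _ ->] /imsetP[U _]].
  by move/setP/(_ ord0); rewrite !cons_set0.
rewrite IHn; congr (_ + _); case: ltnP => [h_gt1|h_le1].
  by rewrite -IHn; apply: eq_card => S; rewrite !inE h_gt1.
by apply: eq_card0 => S; rewrite !inE ltnNge h_le1.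
Qed.

(** * Mesa sets of Stirling permutations are admissible *)

(** Letters as natural numbers, both values and positions being counted from 0;
    this makes positions accessible to arithmetic. *)
Definition value {n} (w : (2 * n).-tuple 'I_n) (j : nat) : nat :=
  nth 0 [seq val x | x <- w] j.

Lemma value_tnth n (w : (2 * n).-tuple 'I_n) (p : 'I_(2 * n)) :
  value w p = tnth w p.
Proof.
by rewrite /value (nth_map (tnth w p)) ?size_tuple // -tnth_nth.
Qed.

Lemma letter_value n (w : (2 * n).-tuple 'I_n) j :
  j < 2 * n -> letter w j.+1 = (value w j).+1.
Proof.
case: n w => [|n] w lt_j; first by rewrite muln0 in lt_j.
by rewrite /letter /value !(nth_map ord0) ?size_tuple.
Qed.

Lemma MesaP n (w : (2 * n).-tuple 'I_n) (v : 'I_n) :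
  reflect (exists j, [/\ j.+3 < 2 * n, value w j < v, value w j.+1 = v,
                         value w j.+2 = v & value w j.+3 < v])
          (v \in Mesa w).
Proof.
rewrite inE; apply: (iffP hasP) => [[[|[|j]]] | [j [lt_j]]].
- by rewrite mem_index_iota.
- by rewrite mem_index_iota.
- rewrite mem_index_iota => /= Hj; rewrite !letter_value; try lia.
  by move=> /and4P[/eqP ? ? /eqP ? ?]; exists j; split; lia.
move=> lt0 eq1 eq2 lt3; exists j.+2; first by rewrite mem_index_iota; lia.
by rewrite /= !letter_value ?eq1 ?eq2; lia.
Qed.

Lemma Q_between n (w : (2 * n).-tuple 'I_n) p j q :
  w \in Q n -> p < j -> j < q -> q < 2 * n -> value w p = value w q ->
  value w p < value w j.
Proof.
rewrite inE => /andP[_ /forallP stir] lt_pj lt_jq lt_q.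
have lt_j := ltn_trans lt_jq lt_q; have lt_p := ltn_trans lt_pj lt_j.
have /forallP/(_ (Ordinal lt_j))/forallP/(_ (Ordinal lt_q)) :=
  stir (Ordinal lt_p).
rewrite -!value_tnth /= lt_pj lt_jq /= => /implyP lt_val eq_pq.
by apply: lt_val; rewrite -val_eqE /= -!value_tnth eq_pq.
Qed.

Lemma Q_count n (w : (2 * n).-tuple 'I_n) v :
  w \in Q n -> #|[set p | tnth w p == v]| = 2.
Proof.
rewrite inE => /andP[/forallP/(_ v)/eqP cnt _]; apply: etrans cnt.
rewrite -[in RHS](map_tnth_enum w) count_map -size_filter cardE /enum_mem.
congr size; rewrite -filter_predI.
by apply: eq_filter => p; rewrite /= inE andbT.
Qed.

(** If a neighbour [y] of the mesa [v] were a mesa, the copy at position [p]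
    would be one of the two copies that form this mesa, since there is no third
    one. But it stands next to [v], which is larger than [y], whereas a letter
    of a mesa has only equal or smaller neighbours. *)
Lemma Mesa_neighbours n (w : (2 * n).-tuple 'I_n) (v : 'I_n) j p :
  w \in Q n -> j.+3 < 2 * n -> value w j < v -> value w j.+1 = v ->
  value w j.+2 = v -> value w j.+3 < v -> (p == j) || (p == j.+3) ->
  forall y : 'I_n, value w p = y -> y \notin Mesa w.
Proof.
move=> wQ lt_j lt0 eq1 eq2 lt3 p_j y Ey; apply/MesaP=> -[i [lt_i i0 i1 i2 i3]].
have btw := @Q_between n w _ _ _ wQ.
have [lt_pi|] := ltnP p i.+1.
  by have := btw p i.+1 i.+2; rewrite Ey i1 i2; lia.
rewrite leq_eqVlt => /orP[/eqP Epi|].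
  by case/orP: p_j => /eqP Ep; rewrite Ep in Epi Ey;
    [|case: Epi => Epi]; subst; lia.
rewrite leq_eqVlt => /orP[/eqP Epi|lt_ip]; last first.
  by have := btw i.+1 i.+2 p; rewrite Ey i1 i2; case/orP: p_j; lia.
by case/orP: p_j => /eqP Ep; rewrite Ep in Epi Ey;
  [|case: Epi => Epi]; subst; lia.
Qed.

(** The injection of mesas into positions is described by its left inverse [g],
    which reads the letter just before a position; this avoids choosing a
    position for each mesa. *)
Lemma Mesa_admissible n (w : (2 * n).-tuple 'I_n) :
  w \in Q n -> admissible 0 (Mesa w).
Proof.
move=> wQ; apply/forallP=> v; rewrite add0n.
have n_gt0 : 0 < n by case: n v {w wQ} => [[]|].
(* The positions of the non-mesa letters up to [v]. *)
pose A := [set p | (tnth w p \notin Mesa w) && (tnth w p <= v)].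
have cardA : #|A| = 2 * #|[set u in ~: Mesa w | u <= v]|.
  rewrite -sum1_card.
  rewrite (partition_big (tnth w) (mem [set u in ~: Mesa w | u <= v])) /=.
    rewrite [RHS]mulnC -sum_nat_const.
    apply: eq_bigr => u; rewrite !inE => u_ok.
    rewrite -[RHS](Q_count _ _ u wQ) -sum1_card; apply: eq_bigl => p.
    rewrite !inE; by case: eqP => [->|]; rewrite ?andbT ?andbF // u_ok.
  by move=> p; rewrite !inE.
rewrite -cardA.
(* The smallest value has no smaller neighbour, so that it is not a mesa. *)
have [p0 p0A] : exists p, p \in A.
  pose z := Ordinal n_gt0.
  have [p] : exists p, p \in [set p | tnth w p == z].
    by apply/set0Pn; rewrite -card_gt0 Q_count.
  rewrite inE => /eqP wp; exists p; rewrite inE wp leq0n andbT.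
  by apply/MesaP=> -[j []].
have [p1 p1A p1min] := @arg_minnP _ p0 (mem A) val p0A.
have prevP (p : 'I_(2 * n)) : p.-1 < 2 * n.
  exact: leq_ltn_trans (leq_pred _) (ltn_ord p).
pose g p := tnth w (Ordinal (prevP p)).
suff sub : [set u in Mesa w | u <= v] \subset g @: (A :\ p1).
  have := leq_trans (subset_leq_card sub) (leq_imset_card _ _).
  by rewrite [#|A|](cardsD1 p1) (p1A : p1 \in A).
apply/subsetP=> u; rewrite inE => /andP[/MesaP[j [lt_j lt0 eq1 eq2 lt3]] le_uv].
have inA p : (val p == j) || (val p == j.+3) -> p \in A.
  move=> p_j; rewrite inE (@Mesa_neighbours n w u j p) -?value_tnth //=.
  by case/orP: p_j => /eqP ->; lia.
(* The position [j] on the left of the mesa is in [A] as well, so that the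
   position [j + 3] on its right is not the leftmost one. *)
have lt_j0 : j < 2 * n by lia.
apply/imsetP; exists (Ordinal lt_j).
  rewrite in_setD1 inA ?eqxx ?orbT // andbT.
  apply/eqP=> E; have := p1min _ (inA (Ordinal lt_j0) _).
  by rewrite -E /= eqxx => /(_ isT); lia.
by apply: val_inj; rewrite /= -value_tnth /= eq2.
Qed.

(** * Admissible sets are mesa sets *)

(** Each mesa goes into the leftmost gap between two non-mesa letters that is
    still free, so that the rest of the non-mesa letters stays a plain tail. *)
Fixpoint weave {T : Type} (s m : seq T) : seq T :=
  match s, m with
  | x :: s', y :: m' => [:: x, y, y & weave s' m']
  | _, _ => s
  end.

Lemma perm_weave (T : eqType) (s m : seq T) :
  size m <= size s -> perm_eq (weave s m) (s ++ m ++ m).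
Proof.
elim: s m => [|x s IHs] [|y m] //=; first by rewrite cats0.
rewrite ltnS => /IHs/permP IH; apply/permP=> a.
by have := IH a; rewrite /= !count_cat /= => ->; rewrite !count_cat /=; lia.
Qed.

Lemma nth_weave_l (T : Type) (x0 : T) s m i : size m <= size s ->
  nth x0 (weave s m) (i + 2 * minn i (size m)) = nth x0 s i.
Proof.
elim: s m i => [|x s IHs] [|y m] [|i] //=; rewrite ?minn0 ?addn0 //.
rewrite ltnS => /IHs <-.
have -> // : i + 2 * minn i.+1 (size m).+1 = (i + 2 * minn i (size m)).+2.
by lia.
Qed.

Lemma nth_weave_r (T : Type) (x0 : T) s m i e : size m <= size s ->
  i < size m -> (e == 1) || (e == 2) ->
  nth x0 (weave s m) (3 * i + e) = nth x0 m i.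
Proof.
move=> + + He; elim: s m i => [|x s IHs] [|y m] [|i] //.
  by case/orP: He => /eqP->.
rewrite !ltnS; have -> : 3 * i.+1 + e = (3 * i + e).+3 by lia.
exact: IHs.
Qed.

(** Position [p] of a woven word holds a letter of one of the two sequences,
    with [a] and [b] the lengths of [m] and [s]. *)
Lemma weave_index a b p : a <= b -> p < 2 * a + b ->
  (exists i, exists e : nat,
    [/\ i < a, (e == 1) || (e == 2) & p = 3 * i + e]) \/
  (exists2 i, i < b & p = i + 2 * minn i a).
Proof.
move=> le_ab lt_p; have [lt_p3|ge_p3] := ltnP p (3 * a).
  have [/eqP p3|p3] := boolP (p %% 3 == 0).
    by right; exists (p %/ 3); lia.
  by left; exists (p %/ 3), (p %% 3); split; lia.
by right; exists (p - 2 * a); lia.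
Qed.

Definition double {T : Type} (s : seq T) : seq T :=
  flatten [seq [:: x; x] | x <- s].

Lemma size_double (T : Type) (s : seq T) : size (double s) = 2 * size s.
Proof. by elim: s => //= x s ->; rewrite mulnS. Qed.

Lemma nth_double (T : Type) (x0 : T) s i : nth x0 (double s) i = nth x0 s i./2.
Proof.
elim: s i => [|x s IHs] i; first by rewrite !nth_nil.
by case: i => [|[|i]] //; apply: IHs.
Qed.

Lemma count_double (T : Type) (a : pred T) s :
  count a (double s) = 2 * count a s.
Proof. by elim: s => //= x s ->; rewrite mulnDr addnA; congr (_ + _); lia. Qed.

(** In an increasing sequence, the entries up to [v] come first. *)
Lemma nth_leq_count n (x0 : 'I_n) (s : seq 'I_n) v i :
  sorted ltn (map val s) -> i < count (fun u : 'I_n => u <= v) s ->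
  nth x0 s i <= v.
Proof.
elim: s i => [|x s IHs] i //= s_sorted.
have [le_xv|lt_vx] := leqP x v; last first.
  rewrite add0n (@eq_in_count _ _ pred0) ?count_pred0 // => u us.
  have /allP/(_ (val u)) := order_path_min ltn_trans s_sorted.
  rewrite map_f // => /(_ isT) /= lt_xu; apply/negbTE.
  by rewrite -ltnNge (ltn_trans lt_vx).
case: i => [|i] //; rewrite add1n ltnS; exact: IHs (path_sorted s_sorted).
Qed.

Lemma ltn_count_nth n (x0 : 'I_n) (s : seq 'I_n) i :
  sorted ltn (map val s) -> i < size s ->
  i < count (fun u : 'I_n => u <= nth x0 s i) s.
Proof.
elim: s i => [|x s IHs] [|i] //= s_sorted lt_i; first by rewrite leqnn.
have /allP/(_ (val (nth x0 s i))) := order_path_min ltn_trans s_sorted.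
rewrite map_f ?mem_nth // => /(_ isT)/ltnW /= ->; rewrite add1n ltnS.
exact: IHs (path_sorted s_sorted) lt_i.
Qed.

Lemma sorted_filter_ord n (a : pred 'I_n) :
  sorted ltn (map val [seq u <- enum 'I_n | a u]).
Proof.
rewrite sorted_map; apply: sorted_filter.
  by move=> y x z; apply: ltn_trans.
by rewrite -sorted_map val_enum_ord iota_ltn_sorted.
Qed.

Lemma count_filter_card n (S : {set 'I_n}) (v : nat) :
  count (fun u : 'I_n => u <= v) [seq u <- enum 'I_n | u \in S] =
  #|[set u in S | u <= v]|.
Proof.
rewrite count_filter -size_filter cardE /enum_mem filter_predT.
by apply: congr1; apply: eq_filter => u; rewrite /= inE andbC.
Qed.

(** The witness is the weaving of the doubled non-mesas with the mesas. *)
Lemma admissible_Mesa n (S : {set 'I_n}) : 0 < n -> admissible 0 S ->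
  exists2 w, w \in Q n & Mesa w = S.
Proof.
move=> n_gt0 /forallP adm; pose x0 := Ordinal n_gt0.
pose N : seq 'I_n := [seq u <- enum 'I_n | u \in ~: S].
pose M : seq 'I_n := [seq u <- enum 'I_n | u \in S].
have Nsorted : sorted ltn (map val N) by exact: sorted_filter_ord.
have Msorted : sorted ltn (map val M) by exact: sorted_filter_ord.
have Muniq : uniq M by apply: filter_uniq; exact: enum_uniq.
have Nuniq : uniq N by apply: filter_uniq; exact: enum_uniq.
have nthN i j : i < j -> j < size N -> nth x0 N i < nth x0 N j.
  move=> lt_ij lt_j; have lt_i := ltn_trans lt_ij lt_j.
  rewrite -!(nth_map x0 0 val) //.
  by apply: (sorted_ltn_nth ltn_trans 0 Nsorted); rewrite ?inE ?size_map.
have nthM i j : i < size M -> j < size M -> nth x0 M i = nth x0 M j -> i = j.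
  by move=> lt_i lt_j /eqP; rewrite nth_uniq // => /eqP.
have memM i : i < size M -> nth x0 M i \in S.
  by move/(mem_nth x0); rewrite mem_filter => /andP[].
have memN i : i < size N -> nth x0 N i \notin S.
  by move/(mem_nth x0); rewrite mem_filter inE => /andP[].
(* The [i + 1] mesas up to [m_i] leave room for at least [i + 2] copies of
   non-mesas up to [m_i]; hence the letters around [m_i] are smaller. *)
have gap i : i < size M -> i.+1 < 2 * size N /\ nth x0 N i.+1./2 < nth x0 M i.
  move=> lt_i; have := ltn_count_nth _ x0 _ _ Msorted lt_i.
  have := adm (nth x0 M i).
  rewrite -!count_filter_card -/M -/N add0n => lt_c le_c.
  have lt_half : i.+1./2 < count (fun u : 'I_n => u <= nth x0 M i) N by lia.
  have lt_N : i.+1./2 < size N := leq_trans lt_half (count_size _ _).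
  split; first by move: lt_N; lia.
  rewrite ltn_neqAle (nth_leq_count _ x0 _ _ _ Nsorted lt_half) andbT.
  by apply/eqP=> /val_inj E; have := memN _ lt_N; rewrite E memM.
have le_sz : size M <= size (double N).
  rewrite size_double; case E: (size M) => [|a] //.
  by have := gap a; rewrite E => -[] //; lia.
have leNM : size M <= 2 * size N by rewrite -size_double.
have szNM : size N + size M = n.
  rewrite !size_filter addnC -[RHS](size_enum_ord n) -(count_predC (mem S)).
  by congr (_ + _); apply: eq_count => u; rewrite !inE.
have szw : size (weave (double N) M) == 2 * n.
  rewrite (perm_size (perm_weave _ _ _ le_sz)) !size_cat size_double.
  by rewrite addnn -mul2n -mulnDr szNM.
pose w := Tuple szw.
have valM i (e : nat) : i < size M -> (e == 1) || (e == 2) ->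
    value w (3 * i + e) = nth x0 M i.
  move=> lt_i He; rewrite /value (nth_map x0) ?(eqP szw) /=; last by lia.
  by rewrite nth_weave_r.
have valN i : i < 2 * size N ->
    value w (i + 2 * minn i (size M)) = nth x0 N i./2.
  move=> lt_i; rewrite /value (nth_map x0) ?(eqP szw) /=; last by lia.
  by rewrite nth_weave_l // nth_double.
have idx p (lt_p : p < 2 * n) : _ :=
  weave_index (size M) (2 * size N) p leNM ltac:(lia).
have neqNM i j : i < size N -> j < size M -> nth x0 N i <> nth x0 M j :> nat.
  by move=> lt_i lt_j /val_inj E; have := memN _ lt_i; rewrite E memM.
have leN i j : i <= j -> j < size N -> nth x0 N i <= nth x0 N j.
  by rewrite leq_eqVlt => /orP[/eqP-> //|lt_ij /(nthN _ _ lt_ij)/ltnW].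
have injN i j : i < size N -> j < size N ->
    nth x0 N i = nth x0 N j :> nat -> i = j.
  move=> lt_i lt_j E; case: (ltngtP i j) => // lt_ij.
    by have := nthN _ _ lt_ij lt_j; lia.
  by have := nthN _ _ lt_ij lt_i; lia.
have wQ : w \in Q n.
  rewrite inE; apply/andP; split.
    apply/forallP=> v; apply/eqP.
    rewrite (permP (perm_weave _ _ _ le_sz)) !count_cat count_double.
    have -> : count_mem v N = (v \notin S).
      by rewrite count_uniq_mem // mem_filter inE mem_enum andbT.
    have -> : count_mem v M = (v \in S).
      by rewrite count_uniq_mem // mem_filter mem_enum andbT.
    by case: (v \in S).
  apply/forallP=> p; apply/forallP=> j; apply/forallP=> q; apply/implyP.
  rewrite -val_eqE /= -!value_tnth => /andP[/andP[lt_pj lt_jq] /eqP].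
  have [[i1 [e1 [lt1 he1 E1]]]|[i1 lt1 E1]] := idx _ (ltn_ord p);
  have [[i2 [e2 [lt2 he2 E2]]]|[i2 lt2 E2]] := idx _ (ltn_ord q);
  rewrite E1 E2 ?valM ?valN // => E.
  - by have := nthM _ _ lt1 lt2 (val_inj E); lia.
  - by case: (neqNM i2./2 i1) => //; lia.
  - by case: (neqNM i1./2 i2) => //; lia.
  (* Equal non-mesa letters are consecutive among the non-mesa letters, so that
     at most one mesa lies between them. *)
  have {E} eq_half : i1./2 = i2./2 by apply: injN E; lia.
  have i2E : i2 = i1.+1 by lia.
  have lt_i1 : i1 < size M by lia.
  have [e [He ->]] : exists e : nat,
      ((e == 1) || (e == 2)) /\ j = 3 * i1 + e :> nat.
    move: lt_pj lt_jq; rewrite E1 E2 i2E => lt_pj lt_jq.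
    by exists (j - 3 * i1); lia.
  have [_] := gap _ lt_i1; rewrite valM //.
  by apply: leq_ltn_trans; apply: leN; lia.
exists w => //; apply/setP=> v; apply/MesaP/idP; last first.
  move=> vS; have [i lt_i Ev] : exists2 i, i < size M & v = nth x0 M i.
    have vM : v \in M by rewrite mem_filter vS mem_enum.
    by exists (index v M); rewrite ?index_mem // nth_index.
  have [lt_i1 lt_gap] := gap _ lt_i; exists (3 * i).
  have := valM i 1 lt_i isT; have := valM i 2 lt_i isT.
  rewrite -Ev addn1 addn2 => -> ->.
  have := valN i ltac:(lia); have := valN i.+1 lt_i1.
  have -> : i.+1 + 2 * minn i.+1 (size M) = (3 * i).+3 by lia.
  have -> : i + 2 * minn i (size M) = 3 * i by lia.
  move=> -> ->; rewrite -Ev in lt_gap; split=> //; try lia.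
  by apply: leq_ltn_trans lt_gap; apply: leN; lia.
(* Two adjacent equal letters that are not in [S] lie beyond the last element
   of [S], in the increasing tail of the word. *)
move=> [j [lt_j _ + +]].
have [[i1 [e1 [lt1 he1 E1]]]|[i1 lt1 E1]] := idx j.+1 ltac:(lia).
  by rewrite E1 valM // => /val_inj <-; rewrite memM.
have [[i2 [e2 [lt2 he2 E2]]]|[i2 lt2 E2]] := idx j.+2 ltac:(lia).
  rewrite E2 E1 valM // valN // => <- E.
  by case: (neqNM i1./2 i2) => //; lia.
have [[i3 [e3 [lt3 he3 E3]]]|[i3 lt3 E3]] := idx j.+3 lt_j; first by lia.
rewrite E3 E1 !valN // => <- _; rewrite ltnNge leN //; lia.
Qed.

(** * The cardinality *)

Lemma AMS_admissible n : 0 < n -> AMS n = [set S | admissible 0 S].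
Proof.
move=> n_gt0; apply/setP=> S; rewrite inE; apply/imsetP/idP.
  by case=> w wQ ->; apply: Mesa_admissible.
by case/(admissible_Mesa _ _ n_gt0) => w wQ <-; exists w.
Qed.

Lemma sum_residue2 (f : nat -> nat) k r : r < 3 ->
  (forall j, j %% 3 != 2 -> f j = 0) ->
  \sum_(0 <= j < 3 * k + r) f j = \sum_(0 <= u < k) f (3 * u + 2).
Proof.
move=> lt_r f0; rewrite (@big_cat_nat _ _ _ (3 * k)) ?leq_addr //=.
rewrite [X in _ + X]big_nat_cond [X in _ + X]big1 ?addn0; last first.
  by move=> j /andP[/andP[? ?] _]; apply: f0; lia.
elim: k => [|k IHk]; first by rewrite !big_geq.
have -> : 3 * k.+1 = (3 * k).+3 by lia.
rewrite !big_nat_recr //= IHk f0 ?[f (3 * k).+1]f0 ?addn0 ?addn2 //; lia.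
Qed.

Lemma first_passage_bin u :
  u.+1 * first_passage (3 * u + 2) 2 = 'C(3 * u + 1, u).
Proof.
have ballot := first_passage_ballot u 2.
have down := mul_bin_down (3 * u + 2) u.
have Em : 3 * u + 2 - u = 2 * u.+1 by lia.
have Ep : (3 * u + 2).-1 = 3 * u + 1 by lia.
rewrite Em Ep in down; apply/eqP.
have /eqn_pmul2l <- : 0 < 3 * u + 2 by rewrite addn2.
by rewrite mulnCA ballot mulnCA mulnA down.
Qed.

Import GRing.Theory Num.Theory.
Local Open Scope ring_scope.

Lemma rat_catalan_first_passage u :
  rat_catalan (2 * u.+1 - 1) u.+1 = (first_passage (3 * u + 2) 2)%:R.
Proof.
rewrite /rat_catalan -bin_sub; last by lia.
have -> : (u.+1 + (2 * u.+1 - 1) - 1 - (2 * u.+1 - 1) = u)%N by lia.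
have -> : (u.+1 + (2 * u.+1 - 1) - 1 = 3 * u + 1)%N by lia.
by rewrite -first_passage_bin natrM mulKf // pnatr_eq0.
Qed.

Theorem corollary4p12 (n k r : nat) (hn : (1 <= n)%N) (hr : (r < 3)%N)
    (hnkr : n = (3 * k + r)%N) :
  (#|AMS n|)%:R =
  2 ^+ (n - 1) -
  \sum_(0 <= i < k) 2 ^+ (3 * i + r) * rat_catalan (2 * (k - i) - 1) (k - i)
  :> rat.
Proof.
have -> : #|AMS n| = survivors n.-1 2.
  rewrite AMS_admissible // card_admissible.
  by case: n hn {hnkr} => //= m _; rewrite addn0.
have := survivors_first_passage n.-1 2 isT; rewrite prednK // subn1.
move: (survivors _ _) => G; rewrite {1}hnkr sum_residue2 //; last first.
  move=> j j3; case E: (first_passage _ _) => [//|c].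
  by have [|u Eu] := first_passage_support j 2; rewrite ?E //; lia.
move=> /(congr1 (fun m => m%:R : rat)); rewrite natrD natrX => <-.
rewrite big_nat_rev natr_sum; set A := (X in _ + X - _); set B := (X in _ - X).
(* The index [i] stands for [u = k - 1 - i] steps up before the first visit to
   0, not counting the forced one at the start. *)
suff -> : B = A by rewrite addrK.
apply: eq_big_nat => i lt_i; rewrite add0n natrM natrX mulrC.
rewrite -rat_catalan_first_passage.
have -> : ((k - i.+1).+1 = k - i)%N by lia.
by congr (_ * 2 ^+ _); lia.
Qed.
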